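(* The Minkowski measure $?'$ is given by the infinite product of piecewise continuous functions $$?'(y)=\prod_{k=0}^{\infty}\frac{(A'\circ A_k)(y)}{2},$$ as an identity of measures on $[0,1]$; that is, for all $0\le a\le b\le 1$, $$?(b)-?(a)=\lim_{N\to\infty}\int_a^b\ \prod_{k=0}^{N-1}\frac{A'(A_k(y))}{2}\,dy .$$
   Context: The Minkowski Question Mark function $?:[0,1]\to[0,1]$ is defined as follows. For rational $x\in[0,1]$ with finite continued fraction $x=[0;a_1,a_2,\dots,a_N]$ (positive integers $a_k$), $?(x)=2\sum_{k=1}^{N}(-1)^{k+1}2^{-(a_1+a_2+\cdots+a_k)}$ (with $?(0)=0$, $?(1)=1$). For irrational $x=[0;a_1,a_2,\dots]$ one takes the limit $N\to\infty$ of this sum. The function is continuous and strictly increasing. The Minkowski measure $?'$ is the Lebesgue-Stieltjes measure on $[0,1]$ assigning mass $?(b)-?(a)$ to the interval from $a$ to $b$ (the notation $?'$ is an abuse: it is a measure, not a classical derivative). The function $A$ is $$A(y)=\begin{cases}\dfrac{y}{1-y} & 0\le y\le \tfrac12,\\[1ex] \dfrac{2y-1}{y} & \tfrac12\le y\le 1,\end{cases}\qquad A'(y)=\begin{cases}\dfrac{1}{(1-y)^2} & 0\le y\le \tfrac12,\\[1ex] \dfrac{1}{y^2} & \tfrac12\le y\le 1,\end{cases}$$ (the value of $A$ at the single point $y=\tfrac12$, where the branches disagree, is immaterial). The iterates are $A_0(y)=y$ and $A_{k+1}=A_k\circ A$. *)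

(* Defs.v *)
From HB Require Import structures.
From mathcomp Require Import all_boot all_order all_algebra.
From mathcomp Require Import all_classical all_reals all_analysis.
Import Order.TTheory GRing.Theory Num.Theory.
Import numFieldNormedType.Exports.

Set Implicit Arguments.
Unset Strict Implicit.
Unset Printing Implicit Defensive.

Local Open Scope classical_set_scope.
Local Open Scope ring_scope.

(** [cfrac R [:: a_1; ...; a_N]] is the finite continued fraction
    [0; a_1, ..., a_N]; the empty sequence gives 0. *)
Definition cfrac (R : realType) (s : seq nat) : R :=
  foldr (fun (a : nat) (y : R) => (a%:R + y)^-1) 0 s.

(** Indices are shifted by one: the term of index [k] below involves
    a_1 + ... + a_(k+1), hence the sign (-1)^k instead of (-1)^(k+1). *)
Definition question_sum (R : realType) (s : seq nat) : R :=
  2 * \sum_(k < size s) (-1) ^+ k * 2 ^- sumn (take k.+1 s).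

(** The first case covers the rationals of [0, 1]: 0 is obtained from [::] and
    1 from [:: 1]. A rational in ]0, 1] has two finite expansions,
    [..., a, 1] and [..., a + 1], and both give the same sum. The second case
    covers the irrationals, as an infinite continued fraction with positive
    digits always has an irrational value. *)
Definition is_question (R : realType) (x v : R) : Prop :=
  (exists s : seq nat,
     [/\ all (fun d => 0 < d)%N s, x = cfrac R s & v = question_sum R s]) \/
  (exists a : nat -> nat,
     [/\ forall k, (0 < a k)%N,
         (fun n => cfrac R (mkseq a n)) @ \oo --> x
       & (fun n => question_sum R (mkseq a n)) @ \oo --> v]).

(** On [0, 1] there is exactly one [v] with [is_question x v]; outside [0, 1]
    there is none and the value is the junk value 0. *)
Definition question (R : realType) (x : R) : R := xget 0 (is_question x).

Definition mapA (R : realType) (y : R) : R :=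
  if y <= 2^-1 then y / (1 - y) else (2 * y - 1) / y.

(** The branchwise derivative of [mapA]; both branches give 4 at 1/2. *)
Definition mapA' (R : realType) (y : R) : R :=
  if y <= 2^-1 then (1 - y) ^- 2 else y ^- 2.

(* Main.v *)
Require Import Defs.
From HB Require Import structures.
From mathcomp Require Import all_boot all_order all_algebra.
From mathcomp Require Import all_classical all_reals all_analysis.
From mathcomp Require Import measurable_realfun ring lra.
Import Order.TTheory GRing.Theory Num.Theory.
Import numFieldNormedType.Exports.

Set Implicit Arguments.
Unset Strict Implicit.
Unset Printing Implicit Defensive.

Local Open Scope classical_set_scope.
Local Open Scope ring_scope.

(** The question mark function satisfies ?(A y) = 2 ?(y) on [0, 1/2] and
    ?(A y) = 2 ?(y) - 1 on [1/2, 1], and the distribution function F_N of the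
    N-th partial product satisfies F_(N+1)(y) = F_N(A y) / 2, resp.
    (1 + F_N(A y)) / 2, with F_0(y) = y. This recursion halves distances, so
    F_N converges uniformly, and its limit L is continuous with
    L(1 - x) = 1 - L(x), hence L(1/(a + t)) = 2^(1-a) - 2^(-a) L(t). That is
    the recursion of the continued fraction sum, so L agrees with it on finite
    continued fractions and, by continuity, everywhere. *)

(** * Approximants of the question mark function *)

Fixpoint questionN (R : realType) (N : nat) (x : R) : R :=
  if N is N'.+1 then
    if x <= 2^-1 then questionN N' (mapA x) / 2
    else (1 + questionN N' (mapA x)) / 2
  else x.

Section QuestionApprox.
Variable R : realType.
Implicit Types x y t : R.

Lemma mapA_le x : x <= 2^-1 -> mapA x = x / (1 - x).
Proof. by rewrite /mapA => ->. Qed.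

Lemma mapA_gt x : 2^-1 < x -> mapA x = 2 - x^-1.
Proof.
move=> hx; rewrite /mapA leNgt hx /=.
by field; rewrite gt_eqF //; apply: lt_trans hx; rewrite invr_gt0.
Qed.

Lemma mapA_left_itv x : 0 <= x <= 2^-1 -> 0 <= x / (1 - x) <= 1.
Proof.
move=> /andP[x0 x1]; have h : 0 < 1 - x by lra.
by rewrite divr_ge0 ?ler_pdivrMr //; lra.
Qed.

Lemma mapA_right_itv x : 2^-1 <= x <= 1 -> 0 <= 2 - x^-1 <= 1.
Proof.
move=> /andP[x0 x1]; have x_gt0 : 0 < x by lra.
have h1 : x^-1 <= 2 by rewrite -[leRHS]invrK lef_pV2 // posrE invr_gt0.
have h2 : 1 <= x^-1 by rewrite -[leLHS]invr1 lef_pV2 // posrE.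
by apply/andP; split; lra.
Qed.

Lemma mapA_itv x : 0 <= x <= 1 -> 0 <= mapA x <= 1.
Proof.
move=> /andP[x0 x1]; have [h|h] := leP x 2^-1.
  by rewrite mapA_le // mapA_left_itv // x0.
by rewrite mapA_gt // mapA_right_itv // x1 ltW.
Qed.

Lemma questionN_at0 N : questionN N (0 : R) = 0.
Proof.
elim: N => //= N IH; rewrite invr_ge0 ler0n mapA_le ?invr_ge0 ?ler0n //.
by rewrite !mul0r IH mul0r.
Qed.

Lemma questionN_at1 N : questionN N (1 : R) = 1.
Proof.
elim: N => //= N IH; have h : 2^-1 < 1 :> R by lra.
rewrite leNgt h /= mapA_gt // invr1 (_ : 2 - 1 = 1) ?IH; lra.
Qed.

Lemma questionNS_le N x : x <= 2^-1 ->
  questionN N.+1 x = questionN N (x / (1 - x)) / 2.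
Proof. by move=> h; rewrite /= h mapA_le. Qed.

(** The right-hand recursion also holds at 1/2, although [mapA] takes its left branch there: the
    branches send 1/2 to 1 and to 0, and both give the value 1/2. *)
Lemma questionNS_ge N x : 2^-1 <= x ->
  questionN N.+1 x = (1 + questionN N (2 - x^-1)) / 2.
Proof.
rewrite le_eqVlt => /predU1P[<-|h]; last by rewrite /= leNgt h /= mapA_gt.
rewrite questionNS_le // invrK subrr questionN_at0 (_ : 2^-1 / (1 - 2^-1) = 1).
  by rewrite questionN_at1 addr0.
by field.
Qed.

Lemma questionN_itv N x : 0 <= x <= 1 -> 0 <= questionN N x <= 1.
Proof.
elim: N x => //= N IH x /mapA_itv/IH /andP[h0 h1].
by case: ifP => _; apply/andP; split; lra.
Qed.

(** The constant 4 bounds the slope (1 - x)^-2 on [0, 1/2]. *)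
Lemma mapA_left_lip x y : 0 <= x <= 2^-1 -> 0 <= y <= 2^-1 ->
  `|x / (1 - x) - y / (1 - y)| <= 4 * `|x - y|.
Proof.
move=> /andP[x0 x1] /andP[y0 y1].
have -> : x / (1 - x) - y / (1 - y) = ((1 - x) * (1 - y))^-1 * (x - y).
  by field; rewrite !lt0r_neq0 //; lra.
rewrite normrM ler_wpM2r //.
have h : 4^-1 <= (1 - x) * (1 - y) by nra.
have h' : 0 < (1 - x) * (1 - y) by nra.
rewrite ger0_norm; last by rewrite invr_ge0 ltW.
by rewrite -[leRHS]invrK lef_pV2 // posrE; lra.
Qed.

Lemma mapA_right_lip x y : 2^-1 <= x -> 2^-1 <= y ->
  `|(2 - x^-1) - (2 - y^-1)| <= 4 * `|x - y|.
Proof.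
move=> x0 y0.
have -> : (2 - x^-1) - (2 - y^-1) = (x * y)^-1 * (x - y).
  by field; rewrite !lt0r_neq0 //; lra.
rewrite normrM ler_wpM2r //.
have h : 4^-1 <= x * y by nra.
have h' : 0 < x * y by nra.
rewrite ger0_norm; last by rewrite invr_ge0 ltW.
by rewrite -[leRHS]invrK lef_pV2 // posrE; lra.
Qed.

(** Each level costs a factor 2: a branch of A stretches by at most 4 and the recursion halves. *)
Lemma questionN_lip N x y : 0 <= x <= 1 -> 0 <= y <= 1 ->
  `|questionN N x - questionN N y| <= 2 ^+ N * `|x - y|.
Proof.
elim: N x y => [|N IH] x y hx hy; first by rewrite mul1r.
have left_ (a b : R) : 0 <= a <= 2^-1 -> 0 <= b <= 2^-1 ->
    `|questionN N.+1 a - questionN N.+1 b| <= 2 ^+ N.+1 * `|a - b|.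
  move=> ha hb; have [/andP[_ a1] /andP[_ b1]] := (ha, hb).
  rewrite !questionNS_le // -mulrBl normrM (@ger0_norm _ 2^-1) ?invr_ge0 //.
  rewrite ler_pdivrMr //; apply: le_trans (IH _ _ _ _) _; rewrite ?mapA_left_itv //.
  rewrite exprSr -!mulrA ler_wpM2l ?exprn_ge0 //.
  apply: le_trans (mapA_left_lip ha hb) _; lra.
have right_ (a b : R) : 2^-1 <= a <= 1 -> 2^-1 <= b <= 1 ->
    `|questionN N.+1 a - questionN N.+1 b| <= 2 ^+ N.+1 * `|a - b|.
  move=> ha hb; have [/andP[a1 _] /andP[b1 _]] := (ha, hb).
  rewrite !questionNS_ge // -mulrBl normrM (@ger0_norm _ 2^-1) ?invr_ge0 //.
  rewrite ler_pdivrMr // opprD addrACA subrr add0r.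
  apply: le_trans (IH _ _ _ _) _; rewrite ?mapA_right_itv //.
  rewrite exprSr -!mulrA ler_wpM2l ?exprn_ge0 //.
  apply: le_trans (mapA_right_lip a1 b1) _; lra.
wlog xy : x y hx hy / x <= y.
  move=> wl; have [|/ltW] := leP x y; first exact: wl.
  by rewrite distrC [`|x - y|]distrC; exact: wl.
move: hx hy => /andP[x0 x1] /andP[y0 y1].
have [hy|hy] := leP y 2^-1; first by apply: left_; apply/andP; split; lra.
have [hx|hx] := leP x 2^-1; last by apply: right_; apply/andP; split; lra.
(* Here x <= 1/2 < y. Passing through 1/2 loses nothing, since the distances from x to 1/2 and from
   1/2 to y add up to the distance from x to y. *)
rewrite -(subrKA (questionN N.+1 2^-1)).
apply: le_trans (ler_normD _ _) _.
apply: le_trans (lerD (left_ _ _ _ _) (right_ _ _ _ _)) _;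
  try by apply/andP; split; lra.
rewrite -mulrDr ler_wpM2l ?exprn_ge0 //.
by rewrite !ler0_norm; lra.
Qed.

(** At level 0 both values lie in [0, 1]; every further level compares both functions at the same
    point A x and halves the gap. *)
Lemma questionN_dist N m x : 0 <= x <= 1 ->
  `|questionN (N + m) x - questionN N x| <= 2 ^- N.
Proof.
elim: N x => [|N IH] x hx.
  have := questionN_itv m hx; move: hx => /andP[? ?] /andP[? ?].
  by rewrite add0n expr0 invr1 ler_norml /=; apply/andP; split; lra.
have h := IH _ (mapA_itv hx).
rewrite exprSr invfM addSn /=.
have e (u v : R) : (1 + u) / 2 - (1 + v) / 2 = u / 2 - v / 2 by lra.
have [c|c] := leP x 2^-1; rewrite ?e -mulrBl normrM;
  by rewrite (@ger0_norm _ 2^-1) ?invr_ge0 // ler_wpM2r ?invr_ge0.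
Qed.

(** The reflection x |-> 1 - x swaps the two branches of A, and 2 - 1/(1 - x) = 1 - x/(1 - x). The
    claim is invariant under the reflection, so x <= 1/2 may be assumed. *)
Lemma questionN_sym N x : 0 <= x <= 1 ->
  questionN N (1 - x) = 1 - questionN N x.
Proof.
elim: N x => // N IH x.
wlog hx : x / x <= 2^-1.
  move=> wl h; have [|/ltW c] := leP x 2^-1; first by move/wl; exact.
  have e : 1 - (1 - x) = x by ring.
  have := wl (1 - x); rewrite e => -> //; [lra|lra|].
  by move: h => /andP[? ?]; apply/andP; split; lra.
move=> /andP[x0 x1].
rewrite questionNS_ge; last lra.
rewrite questionNS_le // (_ : 2 - _ = 1 - x / (1 - x)).
  by rewrite IH ?mapA_left_itv ?x0 //; lra.
by field; rewrite lt0r_neq0 //; lra.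
Qed.

End QuestionApprox.

(** * The limit function and its agreement with continued fraction sums *)

Definition question_lim (R : realType) (x : R) : R :=
  limn (fun N => questionN N x).

Section QuestionLimit.
Variable R : realType.
Implicit Types x y t : R.

Lemma cvg_half_pow : (fun N => 2 ^- N : R) @ \oo --> (0 : R).
Proof.
under eq_fun do rewrite -exprVn.
by apply: cvg_expr; rewrite ger0_norm ?invr_ge0 //; lra.
Qed.

Lemma cvg_questionN x : 0 <= x <= 1 ->
  (fun N => questionN N x) @ \oo --> question_lim x.
Proof.
move=> hx; apply: cauchy_cvg; apply: cauchy_exP => e e0.
have [N _ hN] : \forall N \near \oo, 2 ^- N < e.
  have /cvgr0Pnorm_lt/(_ e e0) := cvg_half_pow.
  by apply: filterS => N; rewrite ger0_norm ?invr_ge0 ?exprn_ge0.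
exists (questionN N x); exists N => //= n /= Nn.
rewrite -ball_normE /= distrC -(subnKC Nn).
apply: le_lt_trans (questionN_dist _ _ hx) _; exact: hN N (leqnn N).
Qed.

(** Letting m tend to infinity in [questionN_dist]; the bound is uniform in x. *)
Lemma question_lim_dist N x : 0 <= x <= 1 ->
  `|question_lim x - questionN N x| <= 2 ^- N.
Proof.
move=> hx; have h : (fun m => `|questionN m x - questionN N x|) @ \oo -->
    `|question_lim x - questionN N x|.
  by apply: cvg_norm; apply: cvgB; [exact: cvg_questionN|exact: cvg_cst].
rewrite -(cvg_lim _ h) //; apply: limr_le; first by apply/cvg_ex; eexists; exact: h.
by exists N => //= n /= Nn; rewrite -(subnKC Nn) questionN_dist.
Qed.

Lemma question_lim0 : question_lim (0 : R) = 0.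
Proof.
by apply: cvg_lim => //; under eq_fun do rewrite questionN_at0; exact: cvg_cst.
Qed.

Lemma question_lim_left x : 0 <= x <= 2^-1 ->
  question_lim x = question_lim (x / (1 - x)) / 2.
Proof.
move=> hx; have [x0 x1] := andP hx; apply: cvg_lim => //.
rewrite -cvg_shiftS; under eq_fun do rewrite questionNS_le //.
by apply: cvgM; [exact/cvg_questionN/mapA_left_itv|exact: cvg_cst].
Qed.

Lemma question_lim_sym x : 0 <= x <= 1 ->
  question_lim (1 - x) = 1 - question_lim x.
Proof.
move=> hx; apply: cvg_lim => //.
under eq_fun do rewrite questionN_sym //.
by apply: cvgB; [exact: cvg_cst|exact: cvg_questionN].
Qed.

Lemma inv_addn_itv (a : nat) t : (0 < a)%N -> 0 <= t <= 1 ->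
  0 <= (a%:R + t)^-1 <= 1.
Proof.
move=> a0 /andP[t0 t1]; have h : 1 <= a%:R + t.
  have : 1 <= a%:R :> R by rewrite ler1n.
  lra.
by rewrite invr_ge0 invf_le1 ?h; lra.
Qed.

(** Induction on a: the left branch sends 1/(a + 1 + t) to 1/(a + t), which halves the value. For a
    = 1, reflection turns 1/(1 + t) into t/(1 + t), which the left branch sends to t. *)
Lemma question_lim_inv (a : nat) t : (0 < a)%N -> 0 <= t <= 1 ->
  question_lim (a%:R + t)^-1 = 2 * 2 ^- a - 2 ^- a * question_lim t.
Proof.
case: a => // a _ ht; elim: a => [|a IH]; move: (ht) => /andP[t0 t1].
  have ht' : 0 <= t / (1 + t) <= 2^-1.
    rewrite divr_ge0 //; last lra.
    by rewrite ler_pdivrMr; lra.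
  have -> : (1 + t)^-1 = 1 - t / (1 + t) by field; rewrite lt0r_neq0 //; lra.
  rewrite question_lim_sym; last by move: ht' => /andP[? ?]; apply/andP; split; lra.
  rewrite question_lim_left //.
  have -> : t / (1 + t) / (1 - t / (1 + t)) = t.
    by field; rewrite !lt0r_neq0 //; lra.
  rewrite expr1; lra.
have ha : 1 <= a.+1%:R :> R by rewrite ler1n.
rewrite (natrD _ 1 a.+1).
rewrite question_lim_left; last first.
  by rewrite invr_ge0 lef_pV2 ?posrE; [apply/andP; split|..]; lra.
have -> : (1 + a.+1%:R + t)^-1 / (1 - (1 + a.+1%:R + t)^-1) = (a.+1%:R + t)^-1.
  by field; rewrite !lt0r_neq0 //; lra.
rewrite IH (exprS _ a.+1) invfM; lra.
Qed.

Lemma cfrac_itv (s : seq nat) : all (fun d => 0 < d)%N s ->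
  0 <= cfrac R s <= 1.
Proof.
elim: s => [|a s IH] /=; first by rewrite lexx ler01.
by move=> /andP[a0 /IH]; exact: inv_addn_itv.
Qed.

(** Prepending the digit a shifts every later term by one index and adds a to its exponent, hence
    the common factor -2^(-a). *)
Lemma question_sum_cons (a : nat) (s : seq nat) :
  question_sum R (a :: s) = 2 * 2 ^- a - 2 ^- a * question_sum R s.
Proof.
rewrite /question_sum /= big_ord_recl /= take0 /= addn0 expr0 mul1r mulrDr.
congr (_ + _); rewrite [in RHS]mulrCA -mulrN; congr (_ * _).
rewrite mulr_sumr -sumrN; apply: eq_bigr => i _.
rewrite /= /bump /= add1n exprD invfM exprS; ring.
Qed.

Lemma question_lim_cfrac (s : seq nat) : all (fun d => 0 < d)%N s ->
  question_lim (cfrac R s) = question_sum R s.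
Proof.
elim: s => [_|a s IH /= /andP[a0 hs]].
  by rewrite question_lim0 /question_sum big_ord0 mulr0.
by rewrite question_lim_inv ?cfrac_itv // IH // question_sum_cons.
Qed.

(** An e/3 argument: two thirds pay for replacing the limit by a fixed [questionN N], the last one
    for its Lipschitz bound 2^N. *)
Lemma question_lim_cont (u : nat -> R) x : (forall n, 0 <= u n <= 1) ->
  0 <= x <= 1 -> u @ \oo --> x -> (fun n => question_lim (u n)) @ \oo --> question_lim x.
Proof.
move=> hu hx ux; apply/cvgrPdist_lt => e e0.
have e3 : 0 < e / 3 by lra.
have [N _ hN] : \forall N \near \oo, 2 ^- N < e / 3.
  have /cvgr0Pnorm_lt/(_ _ e3) := cvg_half_pow.
  by apply: filterS => N; rewrite ger0_norm ?invr_ge0 ?exprn_ge0.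
have {}hN := hN N (leqnn N).
have p0 : 0 < 2 ^+ N :> R by rewrite exprn_gt0.
have /cvgrPdist_lt/(_ (e / 3 / 2 ^+ N)) := ux; rewrite divr_gt0 //.
move=> /(_ isT); apply: filterS => n; rewrite ltr_pdivlMr //= => hn.
have h1 := question_lim_dist N hx.
have h2 := question_lim_dist N (hu n).
have h3 := questionN_lip N hx (hu n).
have : `|questionN N x - questionN N (u n)| < e / 3.
  by apply: le_lt_trans h3 _; rewrite mulrC.
move: h1 h2; rewrite !ltr_norml !ler_norml => /andP[? ?] /andP[? ?] /andP[? ?].
by apply/andP; split; lra.
Qed.

(** Uniqueness of the value, whichever expansion of x is chosen. *)
Lemma is_question_lim x v : 0 <= x <= 1 -> is_question x v ->
  v = question_lim x.
Proof.
move=> hx [[s [hs -> ->]]|[a [ha cx cv]]]; first by rewrite question_lim_cfrac.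
have hall n : all (fun d => 0 < d)%N (mkseq a n).
  by apply/allP => _ /mapP[k _ ->].
have h := @question_lim_cont _ _ (fun n => cfrac_itv (hall n)) hx cx.
rewrite (_ : (fun _ => _) = fun n => question_sum R (mkseq a n)) in h; last first.
  by apply/funext => n /=; rewrite question_lim_cfrac.
exact: (cvg_unique _ cv h).
Qed.

End QuestionLimit.

(** * Existence of continued fraction expansions via the Gauss map *)

Section ContinuedFractions.
Variable R : realType.
Implicit Types x y t : R.

(** The finite continued fraction with a remainder t added to its last digit; t = 0 gives
    [cfrac]. *)
Definition cfrac_tail (s : seq nat) t : R :=
  foldr (fun (a : nat) y => (a%:R + y)^-1) t s.

Lemma cfrac_tail_itv (s : seq nat) t : all (fun d => 0 < d)%N s ->
  0 <= t <= 1 -> 0 <= cfrac_tail s t <= 1.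
Proof.
move=> + ht; elim: s => //= a s IH /andP[a0 /IH]; exact: inv_addn_itv.
Qed.

Lemma inv_addn_lip (a : nat) x y : (0 < a)%N -> 0 <= x -> 0 <= y ->
  `|(a%:R + x)^-1 - (a%:R + y)^-1| <= `|x - y|.
Proof.
rewrite -(ler1n R) => a1 x0 y0.
have -> : (a%:R + x)^-1 - (a%:R + y)^-1
    = ((a%:R + x) * (a%:R + y))^-1 * (y - x).
  by field; rewrite !lt0r_neq0 //; lra.
rewrite normrM [`|y - x|]distrC ler_piMl // ger0_norm; last first.
  by rewrite invr_ge0 mulr_ge0; lra.
by rewrite invf_le1; nra.
Qed.

(** One digit need not contract uniformly: 1/(1 + x) has slope -1 at 0. Two digits do, because both
    denominators a(b + t) + 1 are at least 2. *)
Lemma inv_addn2_lip (a b : nat) x y : (0 < a)%N -> (0 < b)%N ->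
  0 <= x -> 0 <= y ->
  `|(a%:R + (b%:R + x)^-1)^-1 - (a%:R + (b%:R + y)^-1)^-1| <= 4^-1 * `|x - y|.
Proof.
rewrite -!(ler1n R) => a1 b1 x0 y0.
have h t : 0 <= t -> 2 <= a%:R * (b%:R + t) + 1 by move=> ?; nra.
have [hx hy] := (h _ x0, h _ y0).
have e t : 0 <= t ->
    (a%:R + (b%:R + t)^-1)^-1 = (b%:R + t) / (a%:R * (b%:R + t) + 1).
  move=> t0; have ht := h _ t0; field; rewrite !lt0r_neq0 //; lra.
rewrite !e //.
have -> : (b%:R + x) / (a%:R * (b%:R + x) + 1)
    - (b%:R + y) / (a%:R * (b%:R + y) + 1)
    = ((a%:R * (b%:R + x) + 1) * (a%:R * (b%:R + y) + 1))^-1 * (x - y).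
  by field; rewrite !lt0r_neq0 //; lra.
have p : 4 <= (a%:R * (b%:R + x) + 1) * (a%:R * (b%:R + y) + 1) by nra.
rewrite normrM ler_wpM2r // ger0_norm; last by rewrite invr_ge0; lra.
by rewrite lef_pV2 // posrE; lra.
Qed.

(** Strong induction removing two digits at a time; the extra factor 2 absorbs the unpaired digit of
    an odd length. *)
Lemma cfrac_tail_lip (s : seq nat) x y : all (fun d => 0 < d)%N s ->
  0 <= x <= 1 -> 0 <= y <= 1 ->
  `|cfrac_tail s x - cfrac_tail s y| <= 2 * 2 ^- size s * `|x - y|.
Proof.
move=> + hx hy; have [n] := ubnP (size s).
elim: n s => // n IH [|a [|b s]] /=.
- by move=> _ _; rewrite expr0; have := normr_ge0 (x - y); lra.
- move=> _ /andP[a0 _]; rewrite expr1 divff ?mul1r //.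
  by move: hx hy => /andP[? _] /andP[? _]; exact: inv_addn_lip.
move=> sn /and3P[a0 b0 hs].
have /andP[u0 _] := cfrac_tail_itv hs hx.
have /andP[v0 _] := cfrac_tail_itv hs hy.
apply: le_trans (inv_addn2_lip a0 b0 u0 v0) _.
have := IH s (leq_trans (leqnSn _) sn) hs.
rewrite !exprS !invfM; lra.
Qed.

Definition gauss_digit x : nat := Num.truncn x^-1.

(** The Gauss map, the fractional part of 1/x for x > 0. It fixes 0, as the inverse of 0 is 0 by
    convention. *)
Definition gauss x : R := x^-1 - (gauss_digit x)%:R.

Lemma gauss_digit_gt0 x : 0 < x <= 1 -> (0 < gauss_digit x)%N.
Proof. by move=> /andP[x0 x1]; rewrite truncn_gt0 invf_ge1. Qed.

Lemma gauss_itv x : 0 <= x -> 0 <= gauss x <= 1.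
Proof.
move=> x0; have := @truncn_itv _ x^-1; rewrite invr_ge0 => /(_ x0).
by rewrite /gauss /gauss_digit -natr1 => /andP[? ?]; apply/andP; split; lra.
Qed.

Lemma gaussK x : ((gauss_digit x)%:R + gauss x)^-1 = x.
Proof. by rewrite /gauss addrC subrK invrK. Qed.

Lemma cfrac_of_gauss n x : 0 <= x <= 1 -> iter n gauss x = 0 ->
  exists2 s : seq nat, all (fun d => 0 < d)%N s & x = cfrac R s.
Proof.
elim: n x => [|n IH] x hx; first by move=> /= ->; exists [::].
have [-> _|x0] := eqVneq x 0; first by exists [::].
have /andP[x_ge0 x1] := hx.
rewrite iterSr => /(IH _ (gauss_itv x_ge0))[s hs e].
exists (gauss_digit x :: s); last by rewrite [RHS]/= -/(cfrac R s) -e gaussK.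
by rewrite /= hs gauss_digit_gt0 // lt_neqAle eq_sym x0 x_ge0.
Qed.

Lemma gauss_iter_itv n x : 0 <= x <= 1 -> 0 <= iter n gauss x <= 1.
Proof. by move=> hx; elim: n => //= n /andP[+ _]; exact: gauss_itv. Qed.

Lemma cfrac_tail_gauss n x :
  cfrac_tail (mkseq (fun k => gauss_digit (iter k gauss x)) n) (iter n gauss x)
  = x.
Proof.
(* After the first digit, the digits of x are those of [gauss x]; the index range is shifted to
   expose this. *)
elim: n x => // n IH x; rewrite /mkseq /= (iotaDl 1 0) -map_comp.
rewrite -[RHS]gaussK -iterS iterSr; congr (_ + _)^-1.
rewrite -[RHS](IH (gauss x)); congr cfrac_tail.
by apply: eq_map => k; rewrite /= -iterSr.
Qed.

(** The split is on whether the Gauss orbit of x reaches 0, which yields a finite expansion, or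
    never does, so that all digits are positive and the convergents tend to x. *)
Lemma is_question_ex x : 0 <= x <= 1 -> exists v, is_question x v.
Proof.
move=> hx; have [[n hn]|hn] := pselect (exists n, iter n gauss x = 0).
  have [s hs e] := cfrac_of_gauss hx hn.
  by exists (question_sum R s); left; exists s.
pose a k := gauss_digit (iter k gauss x).
have a0 k : (0 < a k)%N.
  have /andP[h0 h1] := gauss_iter_itv k hx.
  rewrite gauss_digit_gt0 // h1 lt_neqAle h0 !andbT eq_sym.
  by apply/negP => /eqP e; apply: hn; exists k.
have hall n : all (fun d => 0 < d)%N (mkseq a n).
  by apply/allP => _ /mapP[k _ ->].
have cx : (fun n => cfrac R (mkseq a n)) @ \oo --> x.
  have c : (fun n => 2 * 2 ^- n : R) @ \oo --> (0 : R).
    by rewrite -[0](mulr0 2); apply: cvgM; [exact: cvg_cst|exact: cvg_half_pow].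
  move/cvgr0Pnorm_lt: c => c.
  apply/cvgrPdist_lt => e /c; apply: filterS => n.
  apply: le_lt_trans; rewrite -[x](cfrac_tail_gauss n).
  have i0 : 0 <= (0 : R) <= 1 by rewrite lexx ler01.
  have hi := gauss_iter_itv n hx.
  apply: le_trans (cfrac_tail_lip (hall n) hi i0) _.
  rewrite size_mkseq [leRHS]ger0_norm ?mulr_ge0 ?invr_ge0 ?exprn_ge0 //.
  rewrite ler_piMr ?mulr_ge0 ?invr_ge0 ?exprn_ge0 //.
  by move: hi => /andP[? ?]; rewrite subr0 ger0_norm.
exists (question_lim x); right; exists a; split => //.
rewrite (_ : (fun _ => _) = fun n => question_lim (cfrac R (mkseq a n))).
  by apply: question_lim_cont => // n; exact: cfrac_itv.
by apply/funext => n; rewrite question_lim_cfrac.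
Qed.

Lemma question_limE x : 0 <= x <= 1 -> question x = question_lim x.
Proof.
move=> hx; have [v hv] := is_question_ex hx.
rewrite /question; case: xgetP => [w _ /is_question_lim->//|/(_ v)//].
Qed.

End ContinuedFractions.

(** * Partial products as densities, and homographies *)

Section Density.
Variable R : realType.
Implicit Types x y : R.
Local Notation mu := (@lebesgue_measure R).

Definition density (N : nat) y : R :=
  \prod_(0 <= k < N) (mapA' (iter k (@mapA R) y) / 2).

Lemma densityS N y : density N.+1 y = mapA' y / 2 * density N (mapA y).
Proof.
rewrite /density big_nat_recl //=; congr (_ * _).
by apply: eq_bigr => k _; rewrite -iterS iterSr.
Qed.

Lemma density_ge0 N y : 0 <= density N y.
Proof.
apply: prodr_ge0 => k _; rewrite divr_ge0 // /mapA'.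
by case: ifP => _; rewrite invr_ge0 sqr_ge0.
Qed.

(** Inversion is continuous off 0, so the point 0, where it has the default value 0, is treated as a
    separate case. *)
Lemma measurable_invr : measurable_fun [set: R] (@GRing.inv R).
Proof.
have -> : @GRing.inv R = fun x => if x == 0 then 0 else x^-1.
  by apply/funext => x; case: eqVneq => // ->; rewrite invr0.
apply: measurable_fun_if => //; first exact: measurable_fun_eqr.
rewrite setTI; apply: open_continuous_measurable_fun.
  rewrite (_ : _ @^-1` _ = ~` [set 0]).
    by apply: closed_openC; exact: closed_eq.
  by apply/seteqP; split => x /= => [/negbT/eqP|/eqP/negbTE].
by move=> x /[!inE] /= /negbT x0; exact: inv_continuous.
Qed.

Lemma measurable_mapA : measurable_fun [set: R] (@mapA R).
Proof.
apply: measurable_fun_ifT; first exact: measurable_fun_ler.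
- apply: measurable_funM => //; apply: measurableT_comp; first exact: measurable_invr.
  exact: measurable_funB.
- apply: measurable_funM; last exact: measurable_invr.
  by apply: measurable_funB => //; exact: measurable_funM.
Qed.

Lemma measurable_mapA' : measurable_fun [set: R] (@mapA' R).
Proof.
apply: measurable_fun_ifT; first exact: measurable_fun_ler.
- apply: measurableT_comp; first exact: measurable_invr.
  by apply: measurable_funX; exact: measurable_funB.
- apply: measurableT_comp; first exact: measurable_invr.
  exact: measurable_funX.
Qed.

Lemma measurable_density N : measurable_fun [set: R] (density N).
Proof.
elim: N => [|N IH].
  have -> : density 0 = cst 1 by apply/funext => x; rewrite /density big_geq.
  exact: measurable_cst.
have -> : density N.+1 = fun y => mapA' y / 2 * density N (mapA y).
  by apply/funext => y; exact: densityS.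
apply: measurable_funM; first by apply: measurable_funM => //; exact: measurable_mapA'.
exact: measurableT_comp IH measurable_mapA.
Qed.

(* The pull-back of [density N] by the homography y |-> (p y + q)/(r y + s) of
   determinant 1, whose derivative is (r y + s)^-2. Composing a homography with
   a branch of A gives a homography again, so quantifying over all of them
   turns the integral computation into an induction on N that applies the
   fundamental theorem of calculus to homographies only, and never changes
   variables in the discontinuous [density N]. *)
Definition homography_density (N : nat) (p q r s y : R) : R :=
  (r * y + s) ^- 2 * density N ((p * y + q) / (r * y + s)).

Lemma measurable_homography_density N p q r s :
  measurable_fun [set: R] (homography_density N p q r s).
Proof.
have maff u v : measurable_fun [set: R] (fun y => u * y + v).
  by apply: measurable_funD => //; exact: measurable_funM.
apply: measurable_funM.
  apply: measurableT_comp; first exact: measurable_invr.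
  exact: measurable_funX.
apply: measurableT_comp; first exact: measurable_density.
apply: measurable_funM => //.
by apply: measurableT_comp; first exact: measurable_invr.
Qed.

Lemma homography_density_ge0 N p q r s y : 0 <= homography_density N p q r s y.
Proof. by rewrite mulr_ge0 ?density_ge0 // invr_ge0 sqr_ge0. Qed.

(** The quotient rule leaves the determinant over (r y + s)^2, so the integrand is the derivative of
    the homography. *)
Lemma homography_FTC (p q r s c d : R) : p * s - q * r = 1 -> c <= d ->
  (forall y, c <= y <= d -> 0 < r * y + s) ->
  (\int[mu]_(y in `[c, d]) ((r * y + s) ^- 2)%:E =
   ((p * d + q) / (r * d + s) - (p * c + q) / (r * c + s))%:E)%E.
Proof.
move=> det; rewrite le_eqVlt => /predU1P[<-|cd] hpos.
  by rewrite set_itv1 integral_set1 subrr.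
have aff u v y : is_derive y 1 (fun z => u * z + v) u.
  by apply: is_derive_eq; rewrite ?scaler1 ?mulr1 /GRing.scale /=; lra.
have der y : c <= y <= d ->
    is_derive y 1 (fun z => (p * z + q) / (r * z + s)) ((r * y + s) ^- 2).
  move=> /hpos h.
  have nz : r * y + s != 0 by rewrite gt_eqF.
  have hV := @is_deriveV _ (fun z => r * z + s) y r 1 nz (aff r s y).
  have hM := is_deriveM (aff p q y) hV.
  apply: is_derive_eq hM _; rewrite /GRing.scale /=.
  by transitivity ((p * s - q * r) / (r * y + s) ^+ 2);
    [field|rewrite det mul1r].
have cont y : c <= y <= d ->
    {for y, continuous (fun z => (p * z + q) / (r * z + s))}.
  move=> /der h; apply/differentiable_continuous.
  by rewrite -derivable1_diffP; case: h.
rewrite (@continuous_FTC2 _ _ (fun z => (p * z + q) / (r * z + s))) ?EFinB //.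
- apply: derivable_within_continuous => y /[!in_itv] /= /hpos h.
  have nz : r * y + s != 0 by rewrite gt_eqF.
  apply: derivableV; first by rewrite expf_neq0.
  have [hD _] := aff r s y; exact: (@derivableX _ _ (fun z => r * z + s) 2 y 1).
- split.
  + move=> y /[!in_itv] /= /andP[h1 h2].
    by have [] := der y; rewrite ?(ltW h1) ?(ltW h2).
  + by apply: cvg_at_right_filter; apply: cont; rewrite lexx ltW.
  + by apply: cvg_at_left_filter; apply: cont; rewrite lexx ltW.
- move=> y /[!in_itv] /= /andP[h1 h2]; rewrite derive1E.
  have hy : c <= y <= d by rewrite !ltW.
  by have [_ ->] := der y hy.
Qed.

End Density.

(** * Integrals of the partial products *)

Section DensityIntegral.
Variable R : realType.
Implicit Types p q r s c d x y : R.
Local Notation mu := (@lebesgue_measure R).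

Lemma homography_lt p q r s x y : p * s - q * r = 1 ->
  0 < r * x + s -> 0 < r * y + s -> x < y ->
  (p * x + q) / (r * x + s) < (p * y + q) / (r * y + s).
Proof.
move=> det hx hy xy; rewrite ltr_pdivrMr // mulrAC ltr_pdivlMr //.
have -> : (p * y + q) * (r * x + s) =
    (p * x + q) * (r * y + s) + (y - x) * (p * s - q * r) by ring.
by rewrite det mulr1 ltrDl subr_gt0.
Qed.

(** The left branch is itself a homography of determinant 1; composing with it subtracts the
    numerator from the denominator. By the chain rule the derivative factors merge into one, leaving
    the 1/2. *)
Lemma homography_densityS_le N p q r s y : 0 < r * y + s ->
  (p * y + q) / (r * y + s) <= 2^-1 ->
  homography_density N.+1 p q r s y =
  2^-1 * homography_density N p q (r - p) (s - q) y.
Proof.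
move=> h hM; rewrite /homography_density densityS mapA_le // /mapA' hM.
have h' : 0 < (r - p) * y + (s - q).
  by move: hM; rewrite ler_pdivrMr //; lra.
have -> : (p * y + q) / (r * y + s) / (1 - (p * y + q) / (r * y + s)) =
    (p * y + q) / ((r - p) * y + (s - q)).
  field; rewrite !lt0r_neq0 //; lra.
rewrite [LHS]mulrA [RHS]mulrA; congr (_ * _).
by field; rewrite !lt0r_neq0 //; lra.
Qed.

(** The same for the right branch y |-> (2y - 1)/y. *)
Lemma homography_densityS_gt N p q r s y : 0 < r * y + s ->
  2^-1 < (p * y + q) / (r * y + s) ->
  homography_density N.+1 p q r s y =
  2^-1 * homography_density N (2 * p - r) (2 * q - s) p q y.
Proof.
move=> h hM; rewrite /homography_density densityS mapA_gt // /mapA' leNgt hM /=.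
have h' : 0 < p * y + q by move: hM; rewrite ltr_pdivlMr //; lra.
have -> : 2 - ((p * y + q) / (r * y + s))^-1 =
    ((2 * p - r) * y + (2 * q - s)) / (p * y + q).
  by field; rewrite !lt0r_neq0 //; lra.
rewrite [LHS]mulrA [RHS]mulrA; congr (_ * _).
by field; rewrite !lt0r_neq0 //; lra.
Qed.

Lemma integral_half_homography_density N p q r s c d :
  (\int[mu]_(y in `[c, d]) (2^-1 * homography_density N p q r s y)%:E =
   (2^-1)%:E * \int[mu]_(y in `[c, d]) (homography_density N p q r s y)%:E)%E.
Proof.
under eq_integral do rewrite EFinM.
rewrite ge0_integralZl //.
- apply/measurable_EFinP; apply: measurable_funTS.
  exact: measurable_homography_density.
- by move=> y _; rewrite lee_fin homography_density_ge0.
Qed.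

(** Where the homography stays on one side of 1/2, a single branch applies and the induction
    hypothesis is used for the composed homography. Otherwise the interval is cut where the value
    1/2 is taken. *)
Lemma integral_homography_density N p q r s c d : p * s - q * r = 1 ->
  c <= d -> (forall y, c <= y <= d -> 0 < r * y + s) ->
  (forall y, c <= y <= d -> 0 <= (p * y + q) / (r * y + s) <= 1) ->
  (\int[mu]_(y in `[c, d]) (homography_density N p q r s y)%:E =
   (questionN N ((p * d + q) / (r * d + s)) -
    questionN N ((p * c + q) / (r * c + s)))%:E)%E.
Proof.
elim: N p q r s c d => [|N IH] p q r s c d det cd hpos hM.
  under eq_integral do rewrite /homography_density /density big_geq // mulr1.
  exact: homography_FTC.
have meas (D : set R) :
    measurable_fun D (EFin \o homography_density N.+1 p q r s).
  apply/measurable_EFinP; apply: measurable_funTS.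
  exact: measurable_homography_density.
have le_side a b : c <= a -> a <= b -> b <= d ->
    (p * b + q) / (r * b + s) <= 2^-1 ->
    (\int[mu]_(y in `[a, b]) (homography_density N.+1 p q r s y)%:E =
     (questionN N.+1 ((p * b + q) / (r * b + s)) -
      questionN N.+1 ((p * a + q) / (r * a + s)))%:E)%E.
  move=> ca ab bd hb.
  have in_cd y : a <= y <= b -> c <= y <= d.
    by move=> /andP[? ?]; apply/andP; split; lra.
  have half y : a <= y <= b -> (p * y + q) / (r * y + s) <= 2^-1.
    move=> hy; apply: le_trans hb; have [_] := andP hy.
    rewrite le_eqVlt => /predU1P[->//|yb].
    apply/ltW/homography_lt => //; apply: hpos; first exact: in_cd.
    by apply: in_cd; rewrite ab /=.
  have pos y : a <= y <= b -> 0 < (r - p) * y + (s - q).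
    move=> hy; have := half _ hy; rewrite ler_pdivrMr ?hpos ?in_cd //.
    have := hpos _ (in_cd _ hy); lra.
  have E y : a <= y <= b -> (p * y + q) / (r * y + s) /
      (1 - (p * y + q) / (r * y + s)) = (p * y + q) / ((r - p) * y + (s - q)).
    move=> hy; have h1 := pos _ hy; have h2 := hpos _ (in_cd _ hy).
    by field; rewrite !lt0r_neq0 //; lra.
  rewrite [LHS](_ : _ = \int[mu]_(y in `[a, b])
      (2^-1 * homography_density N p q (r - p) (s - q) y)%:E)%E; last first.
    apply: eq_integral => y; rewrite inE /= in_itv /= => hy.
    by rewrite homography_densityS_le ?half // hpos ?in_cd.
  rewrite integral_half_homography_density IH //; first last.
  - move=> y hy; rewrite -E // mapA_left_itv // half // andbT.
    by have /andP[] := hM _ (in_cd _ hy).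
  - rewrite -det; ring.
  rewrite !questionNS_le ?half ?lexx ?ab // !E ?lexx ?ab //.
  by rewrite -EFinM -mulrBl mulrC.
have ge_side a b : c <= a -> a <= b -> b <= d ->
    2^-1 <= (p * a + q) / (r * a + s) ->
    (\int[mu]_(y in `[a, b]) (homography_density N.+1 p q r s y)%:E =
     (questionN N.+1 ((p * b + q) / (r * b + s)) -
      questionN N.+1 ((p * a + q) / (r * a + s)))%:E)%E.
  move=> ca ab bd ha.
  have in_cd y : a <= y <= b -> c <= y <= d.
    by move=> /andP[? ?]; apply/andP; split; lra.
  have half_lt y : a < y <= b -> 2^-1 < (p * y + q) / (r * y + s).
    move=> /andP[ay yb]; apply: le_lt_trans ha _.
    by apply: homography_lt => //; apply/hpos/in_cd; rewrite ?lexx ?ab ?(ltW ay).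
  have half y : a <= y <= b -> 2^-1 <= (p * y + q) / (r * y + s).
    move=> /andP[]; rewrite le_eqVlt => /predU1P[<-//|ay yb].
    by apply/ltW/half_lt; rewrite ay.
  have pos y : a <= y <= b -> 0 < p * y + q.
    move=> hy; have := half _ hy; rewrite ler_pdivlMr ?hpos ?in_cd //.
    have := hpos _ (in_cd _ hy); lra.
  have E y : a <= y <= b -> 2 - ((p * y + q) / (r * y + s))^-1 =
      ((2 * p - r) * y + (2 * q - s)) / (p * y + q).
    move=> hy; have h1 := pos _ hy; have h2 := hpos _ (in_cd _ hy).
    by field; rewrite !lt0r_neq0 //; lra.
  (* The left endpoint is dropped because the homography may equal 1/2 there, where [mapA] uses the
     other branch; it is restored before the induction hypothesis applies. *)
  rewrite -integral_itv_obnd_cbnd; last exact: meas.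
  rewrite [LHS](_ : _ = \int[mu]_(y in `]a, b])
      (2^-1 * homography_density N (2 * p - r) (2 * q - s) p q y)%:E)%E; last first.
    apply: eq_integral => y; rewrite inE /= in_itv /= => /andP[ay yb].
    rewrite homography_densityS_gt ?half_lt ?ay // hpos // in_cd //.
    by rewrite (ltW ay).
  rewrite integral_itv_obnd_cbnd; last first.
    apply/measurable_EFinP; apply: measurable_funTS; apply: measurable_funM => //.
    exact: measurable_homography_density.
  rewrite integral_half_homography_density IH //; first last.
  - move=> y hy; rewrite -E // mapA_right_itv // half //.
    by have /andP[] := hM _ (in_cd _ hy).
  - rewrite -det; ring.
  rewrite !questionNS_ge ?half ?lexx ?ab // !E ?lexx ?ab //.
  by rewrite -EFinM; congr EFin; lra.
have hc := hpos c; have hd := hpos d.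
rewrite lexx cd in hc; rewrite lexx cd in hd.
move: hc hd => /(_ isT) hc /(_ isT) hd.
have [hd2|hd2] := leP ((p * d + q) / (r * d + s)) 2^-1.
  exact: le_side.
have [hc2|hc2] := leP 2^-1 ((p * c + q) / (r * c + s)).
  exact: ge_side.
(* The affine form 2(p y + q) - (r y + s) has the sign of the homography minus 1/2. It is negative
   at c and positive at d, so its slope is positive and its root m lies in [c, d]. *)
have {}hd2 : 0 < (2 * p - r) * d + (2 * q - s).
  by move: hd2; rewrite ltr_pdivlMr //; lra.
have {}hc2 : (2 * p - r) * c + (2 * q - s) < 0.
  by move: hc2; rewrite ltr_pdivrMr //; lra.
have k0 : 0 < 2 * p - r.
  have : 0 < (2 * p - r) * (d - c) by lra.
  rewrite pmulr_lgt0 // subr_gt0 lt_neqAle cd andbT.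
  by apply/negP => /eqP e; move: hc2 hd2; rewrite e; lra.
pose m := (s - 2 * q) / (2 * p - r).
have cm : c <= m by rewrite ler_pdivlMr //; lra.
have md : m <= d by rewrite ler_pdivrMr //; lra.
have hm : 0 < r * m + s by apply: hpos; rewrite cm.
have Em : (p * m + q) / (r * m + s) = 2^-1.
  have -> : p * m + q = 2^-1 * (r * m + s).
    by rewrite /m; field; rewrite lt0r_neq0.
  by rewrite mulfK // lt0r_neq0.
have := le_side c m (lexx c) cm md; have := ge_side m d cm md (lexx d).
rewrite Em lexx => /(_ isT) I2 /(_ isT) I1.
rewrite (@itv_bndbnd_setU _ _ _ (BRight m)) ?bnd_simp //.
rewrite ge0_integral_setU //; first last.
- apply/disj_set2P; rewrite -subset0 => y [] /=; rewrite !in_itv /=.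
  by move=> /andP[_ h1] /andP[h2 _]; move: (le_lt_trans h1 h2); rewrite ltxx.
- by move=> y _; rewrite lee_fin homography_density_ge0.
- exact: meas.
rewrite integral_itv_obnd_cbnd; last exact: meas.
by rewrite [X in (X + _)%E]I1 [X in (_ + X)%E]I2 -EFinD; congr EFin; lra.
Qed.

End DensityIntegral.

Theorem mainTheorem2 (R : realType) (a b : R)
    (ha : 0 <= a) (hab : a <= b) (hb : b <= 1) :
  (fun N : nat =>
     (\int[lebesgue_measure]_(y in `[a, b])
        (\prod_(0 <= k < N) (mapA' (iter k (@mapA R) y) / 2))%:E)%E : \bar R) @ \oo
  --> ((question b - question a)%:E : \bar R).
Proof.
have a01 : 0 <= a <= 1 by rewrite ha (le_trans hab).
have b01 : 0 <= b <= 1 by rewrite hb (le_trans ha).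
(* The partial product is its own pull-back by the identity homography, p = s = 1 and q = r = 0. *)
have id_homography (y : R) : (1 * y + 0) / (0 * y + 1) = y.
  by rewrite mul1r addr0 mul0r add0r divr1.
have E N : (\int[lebesgue_measure]_(y in `[a, b])
    (\prod_(0 <= k < N) (mapA' (iter k (@mapA R) y) / 2))%:E =
    (questionN N b - questionN N a)%:E)%E.
  rewrite -[in RHS](id_homography b) -[in RHS](id_homography a).
  rewrite -integral_homography_density //.
  - apply: eq_integral => y _.
    by rewrite /homography_density id_homography mul0r add0r expr1n invr1 mul1r.
  - ring.
  - by move=> y _; rewrite mul0r add0r.
  - move=> y /andP[ay yb]; rewrite id_homography.
    by rewrite (le_trans ha ay) (le_trans yb hb).
under eq_fun do rewrite E.
rewrite !question_limE //; apply: cvg_EFin; first by apply: nearW.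
by apply: cvgB; exact: cvg_questionN.
Qed.
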